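(* Let $\mathbb{K}$ be a field, let $X$ be a triangulable topological space, and let $A, B \subseteq X$ be nonempty subspaces such that $X = A^{\circ} \cup B^{\circ}$ (interiors taken in $X$). Let $\{X_i\}_{i \in \mathbb{N}}$ be a filtration of $X$, and let $\{A_i\}_{i\in\mathbb{N}}$ and $\{B_i\}_{i\in\mathbb{N}}$ be filtrations of $A$ and $B$ respectively such that, for every $i$, $A_i, B_i \subseteq X_i$ and $X_i = A_i^{\circ} \cup B_i^{\circ}$, where the interiors of $A_i$ and $B_i$ are taken in $X_i$ with its subspace topology from $X$. Equip $A\cap B$ with the filtration $(A\cap B)_i = A_i \cap B_i$. Then for every $k \in \mathbb{N}$ there is an isomorphism of persistence modules $$\mathcal{H}_k(X, A) \cong \mathcal{H}_k(B, A\cap B),$$ and for every $k \in \mathbb{N}$ and all $i<j$ there is an isomorphism of persistent homology groups $$H_k^{i,j}(X,A) \cong H_k^{i,j}(B, A\cap B).$$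
   Context: All subspaces of $X$ carry the subspace topology. A filtration $\{X_i\}_{i\in\mathbb{N}}$ of a topological space $X$ is a family of subspaces $X_i \subseteq X$ with $X_i \subseteq X_j$ whenever $i \le j$. A filtration of a pair $(X,A)$, with $A\subseteq X$, is a sequence of pairs $(X_0,A_0)\subseteq (X_1,A_1) \subseteq \cdots \subseteq (X,A)$ with $A_i \subseteq X_i$, $X_i\subseteq X_{i+1}$ and $A_i \subseteq A_{i+1}$ for all $i$. $H_k(Y,C)$ denotes the relative (singular) homology of the pair $(Y,C)$ in degree $k$ with coefficients in the field $\mathbb{K}$; it is a $\mathbb{K}$-vector space. A persistence module over $\mathbb{N}$ is a functor from the poset $(\mathbb{N},\le)$ to $\mathbb{K}$-vector spaces, i.e. a family $\{M_i,\varphi_{i,j}\}_{i\le j}$ of vector spaces $M_i$ and linear maps $\varphi_{i,j}: M_i\to M_j$ with $\varphi_{i,i}=\mathrm{id}$ and $\varphi_{j,k}\circ\varphi_{i,j}=\varphi_{i,k}$. An isomorphism of persistence modules $\{M_i,\varphi_{i,j}\}\to\{N_i,\psi_{i,j}\}$ is a family of linear isomorphisms $f_i: M_i\to N_i$ with $\psi_{i,j}\circ f_i = f_j\circ\varphi_{i,j}$ for all $i\le j$. For a filtered pair $(X,A)$, $\mathcal{H}_k(X,A)$ denotes the persistence module consisting of the vector spaces $H_k(X_i,A_i)$ and the maps $H_k(X_i,A_i)\to H_k(X_j,A_j)$, $i \le j$, induced by the inclusions of pairs $(X_i,A_i)\hookrightarrow (X_j,A_j)$. (Equivalently, it is viewed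 as the graded $\mathbb{K}[t]$-module $\bigoplus_i H_k(X_i,A_i)$ in which $t$ acts by the map from degree $i$ to degree $i+1$.) The relative persistent homology groups are $$H_k^{i,j}(X,A) = \mathrm{im}\big(H_k(X_i,A_i)\to H_k(X_j,A_j)\big).$$ The module $\mathcal{H}_k(B,A\cap B)$ and the groups $H_k^{i,j}(B,A\cap B)$ are defined in the same way from the filtered pair $(B_i,(A\cap B)_i)$. *)

(* Defs.v *)
From HB Require Import structures.
(* freeg exports its own lift and reuses << _ >>: the next line must follow it. *)
From mathcomp Require Import freeg.
From mathcomp Require Import all_boot all_order all_algebra ring_quotient.
From mathcomp Require Import zify finmap.
From mathcomp Require Import all_classical all_reals topology normedtype.

Set Implicit Arguments.
Unset Strict Implicit.
Unset Printing Implicit Defensive.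

Import Order.TTheory GRing.Theory Num.Theory numFieldNormedType.Exports.

Local Open Scope classical_set_scope.
Local Open Scope ring_scope.

Section LinearAlgebra.
Context {K : fieldType}.

Section KerCoker.
Context {U V : lmodType K} (f : {linear U -> V}).

Definition ker_pred : {pred U} := fun u => f u == 0.

Lemma ker_pred_closed : subsemimod_closed ker_pred.
Proof.
split; first split.
- by rewrite unfold_in linear0.
- by move=> u v; rewrite !unfold_in linearD => /eqP-> /eqP->; rewrite addr0.
- by move=> a u; rewrite !unfold_in linearZZ => /eqP->; rewrite scaler0.
Qed.

HB.instance Definition _ := GRing.isSubmodClosed.Build K U ker_pred
  ker_pred_closed.

Definition ker : Type := {u : U | u \in ker_pred}.

HB.instance Definition _ := SubChoice.on ker.
HB.instance Definition _ := [SubChoice_isSubLmodule of ker by <:].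

Definition img_pred : {pred V} := fun v => `[< exists u, f u = v >].

Lemma img_pred_closed : subsemimod_closed img_pred.
Proof.
split; first split.
- by apply/asboolP; exists 0; rewrite linear0.
- move=> _ _ /asboolP[u <-] /asboolP[v <-].
  by apply/asboolP; exists (u + v); rewrite linearD.
- move=> a _ /asboolP[u <-].
  by apply/asboolP; exists (a *: u); rewrite linearZZ.
Qed.

HB.instance Definition _ := GRing.isSubmodClosed.Build K V img_pred
  img_pred_closed.

Definition img : Type := {v : V | v \in img_pred}.

HB.instance Definition _ := SubChoice.on img.
HB.instance Definition _ := [SubChoice_isSubLmodule of img by <:].

Definition coker : Type := Quotient.quot img_pred.

HB.instance Definition _ := GRing.Zmodule.on coker.

Definition coker_pi (v : V) : coker := \pi_(Quotient.quot img_pred)%qT v.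
Definition coker_repr (q : coker) : V := repr (q : Quotient.quot img_pred).

Lemma coker_reprK : cancel coker_repr coker_pi.
Proof. exact: reprK. Qed.

Lemma coker_surj q : exists v, coker_pi v = q.
Proof. by exists (coker_repr q); rewrite coker_reprK. Qed.

Lemma coker_piP (v w : V) : coker_pi v = coker_pi w <-> exists u, f u = v - w.
Proof.
split=> [/eqP|[u fu]].
  by rewrite /coker_pi -Quotient.idealrBE => /asboolP.
by apply/eqP; rewrite /coker_pi -Quotient.idealrBE; apply/asboolP; exists u.
Qed.

Lemma coker_piD : {morph coker_pi : v w / v + w}.
Proof. by move=> v w; rewrite /coker_pi raddfD. Qed.

Definition coker_scale (a : K) (q : coker) : coker :=
  coker_pi (a *: coker_repr q).

Lemma coker_piZ a v : coker_pi (a *: v) = coker_scale a (coker_pi v).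
Proof.
apply/coker_piP.
have /coker_piP[u fu] : coker_pi v = coker_pi (coker_repr (coker_pi v)).
  by rewrite coker_reprK.
by exists (a *: u); rewrite linearZZ fu -scalerBr.
Qed.

Lemma coker_scaleA a b q :
  coker_scale a (coker_scale b q) = coker_scale (a * b) q.
Proof. by rewrite -(coker_reprK q) -!coker_piZ scalerA. Qed.

Lemma coker_scale1 : left_id 1 coker_scale.
Proof. by move=> q; rewrite -(coker_reprK q) -coker_piZ scale1r. Qed.

Lemma coker_scaleDr : right_distributive coker_scale +%R.
Proof.
move=> a q r; rewrite -(coker_reprK q) -(coker_reprK r).
by rewrite -coker_piD -!coker_piZ -coker_piD scalerDr.
Qed.

Lemma coker_scaleDl q : {morph coker_scale^~ q : a b / a + b}.
Proof.
by move=> a b; rewrite -(coker_reprK q) -!coker_piZ -coker_piD scalerDl.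
Qed.

HB.instance Definition _ := GRing.Zmodule_isLmodule.Build K coker
  coker_scaleA coker_scale1 coker_scaleDr coker_scaleDl.

Lemma coker_pi_linear : linear coker_pi.
Proof. by move=> a v w; rewrite coker_piD coker_piZ. Qed.

HB.instance Definition _ := GRing.isLinear.Build K V coker *:%R coker_pi
  coker_pi_linear.

End KerCoker.

Section CokerMap.
Context {U V U' V' : lmodType K}.
Context (f : {linear U -> V}) (f' : {linear U' -> V'}) (g : {linear V -> V'}).
Context (fg : forall u, exists u', f' u' = g (f u)).

(* The compatibility proof is an argument so that the linear structure, which
   needs it, can be inferred from the term. *)
Definition coker_map_fun of (forall u, exists u', f' u' = g (f u)) :=
  fun q : coker f => coker_pi f' (g (coker_repr q)).

Lemma coker_map_funE v : coker_map_fun fg (coker_pi f v) = coker_pi f' (g v).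
Proof.
apply/coker_piP.
have /coker_piP[u fu] : coker_pi f (coker_repr (coker_pi f v)) = coker_pi f v.
  by rewrite coker_reprK.
by have [u' fu'] := fg u; exists u'; rewrite fu' fu linearB.
Qed.

Lemma coker_map_linear : linear (coker_map_fun fg).
Proof.
move=> a q r; rewrite -(coker_reprK q) -(coker_reprK r) -linearP.
by rewrite !coker_map_funE !linearP.
Qed.

HB.instance Definition _ := GRing.isLinear.Build K (coker f) (coker f') *:%R
  (coker_map_fun fg) coker_map_linear.

Definition coker_map : {linear coker f -> coker f'} := coker_map_fun fg.

End CokerMap.

Section KerLift.
Context {U V W : lmodType K} (f : {linear U -> V}) (g : {linear V -> W}).
Context (gf : forall u, g (f u) = 0).

Lemma ker_lift_subproof u : f u \in ker_pred g.
Proof. by rewrite unfold_in gf. Qed.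

Definition ker_lift_fun of (forall u, g (f u) = 0) :=
  fun u : U => exist _ (f u) (ker_lift_subproof u) : ker g.

Lemma ker_lift_linear : linear (ker_lift_fun gf).
Proof. by move=> a u v; apply: val_inj => /=; rewrite linearP. Qed.

HB.instance Definition _ := GRing.isLinear.Build K U (ker g) *:%R
  (ker_lift_fun gf) ker_lift_linear.

Definition ker_lift : {linear U -> ker g} := ker_lift_fun gf.

End KerLift.

End LinearAlgebra.

Section ContinuousMaps.
Context {X Y Z : topologicalType}.

Definition ccomp (g : continuousType Y Z) (f : continuousType X Y) :
  continuousType X Z := g \o f.

Section Corestriction.
Context (f : continuousType X Y) (S : set Y) (fS : forall x, S (f x)).

Definition corestr_fun of (forall x, S (f x)) : X -> S :=
  fun x => exist _ (f x) (mem_set (fS x)).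

Lemma corestr_continuous : continuous (corestr_fun fS).
Proof. by apply: continuous_comp_initial => x; exact: cts_fun. Qed.

HB.instance Definition _ :=
  isContinuous.Build X S (corestr_fun fS) corestr_continuous.

Definition corestr : continuousType X S := corestr_fun fS.

End Corestriction.
End ContinuousMaps.

Section SubspaceInclusion.
Context {X : topologicalType}.

Lemma set_val_continuous (S : set X) : continuous (set_val : S -> X).
Proof. exact: initial_continuous. Qed.

Definition subincl (S : set X) : continuousType S X :=
  mkcts (@set_val_continuous S).

Lemma subincl_in (S : set X) (x : S) : S (subincl S x).
Proof. exact: set_valP. Qed.

Definition incl (S T : set X) (ST : S `<=` T) : continuousType S T :=
  corestr (fun x => ST _ (subincl_in x)).

End SubspaceInclusion.

Lemma mx_continuous (X Y : topologicalType) m n (f : X -> 'M[Y]_(m, n)) :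
  (forall i j, continuous (fun x => f x i j)) -> continuous f.
Proof.
move=> fc x A [P Px PA].
have : \forall y \near x, forall ij : 'I_m * 'I_n, P ij.1 ij.2 (f y ij.1 ij.2).
  by apply: filter_forall => -[i j]; exact: (fc i j x _ (Px i j)).
by apply: filterS => y Py; apply: PA => i j; exact: (Py (i, j)).
Qed.

Section StandardSimplex.
Context (R : realType).

(* Delta^n, in barycentric coordinates. *)
Definition stdsimplex n : set 'rV[R]_n.+1 :=
  [set x | (forall i, 0 <= x 0 i) /\ \sum_i x 0 i = 1].
Arguments stdsimplex : clear implicits.

Section Face.
Context (n : nat) (i : 'I_n.+2).

(* The i-th coface Delta^n -> Delta^n+1: inserts a zero in position i. *)
Definition face_pt (x : 'rV[R]_n.+1) : 'rV[R]_n.+2 :=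
  \row_j (if unlift i j is Some k then x 0 k else 0).

Lemma face_pt_i x : face_pt x 0 i = 0.
Proof. by rewrite mxE unlift_none. Qed.

Lemma face_pt_lift x k : face_pt x 0 (lift i k) = x 0 k.
Proof. by rewrite mxE liftK. Qed.

Lemma face_pt_continuous : continuous face_pt.
Proof.
apply: mx_continuous => a b x; rewrite ord1.
have -> : (fun y => face_pt y 0 b) =
    if unlift i b is Some k then (fun y : 'rV[R]_n.+1 => y 0 k) else cst 0.
  by apply/funext => y; rewrite mxE; case: unlift.
by case: unlift => [k|]; [exact: coord_continuous|exact: cst_continuous].
Qed.

Lemma face_pt_in x : stdsimplex n x -> stdsimplex n.+1 (face_pt x).
Proof.
case=> x0 x1; split=> [j|].
  by rewrite mxE; case: unlift => [k|//]; exact: x0.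
rewrite (bigD1_ord i)//= face_pt_i add0r -x1.
by apply: eq_bigr => k _; rewrite face_pt_lift.
Qed.

End Face.

Section FaceMap.
Context (n : nat) (i : 'I_n.+2).

Lemma face_pt_set_val_continuous :
  continuous (face_pt i \o (set_val : stdsimplex n -> _)).
Proof.
move=> x; apply: continuous_comp; first exact: set_val_continuous.
exact: face_pt_continuous.
Qed.

Definition face : continuousType (stdsimplex n) (stdsimplex n.+1) :=
  @corestr _ _ (mkcts face_pt_set_val_continuous) (stdsimplex n.+1)
    (fun x => face_pt_in i (set_valP x)).

End FaceMap.

Lemma unbump_ltn n (j : 'I_n.+3) (i : 'I_n.+2) : (unbump i j < n.+2)%N.
Proof. by rewrite /unbump; have := ltn_ord j; have := ltn_ord i; lia. Qed.

Lemma lift_swap n (j : 'I_n.+3) (i : 'I_n.+2) :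
  lift (lift j i) (inord (unbump i j) : 'I_n.+2) = j.
Proof.
apply: val_inj => /=; rewrite inordK; last exact: unbump_ltn.
by rewrite /unbump /bump; lia.
Qed.

Lemma lift_lift n (j : 'I_n.+3) (i : 'I_n.+2) (k : 'I_n.+1) :
  lift j (lift i k) = lift (lift j i) (lift (inord (unbump i j)) k).
Proof.
by apply: val_inj => /=; rewrite bumpC inordK//; exact: unbump_ltn.
Qed.

Lemma face_pt_face_pt n (j : 'I_n.+3) (i : 'I_n.+2) (x : 'rV[R]_n.+1) :
  face_pt j (face_pt i x) =
  face_pt (lift j i) (face_pt (inord (unbump i j)) x).
Proof.
apply/rowP => l; case: (unliftP j l) => [l' ->|->]; last first.
  by rewrite face_pt_i -[X in _ = _ 0 X](lift_swap j i) face_pt_lift face_pt_i.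
case: (unliftP i l') => [k ->|->]; last by rewrite face_pt_lift !face_pt_i.
by rewrite [X in _ = _ 0 X]lift_lift !face_pt_lift.
Qed.

Lemma face_face n (j : 'I_n.+3) (i : 'I_n.+2) :
  ccomp (face j) (face i) =
  ccomp (face (lift j i)) (face (inord (unbump i j))).
Proof.
apply/continuousEP => x; apply: val_inj; exact: face_pt_face_pt.
Qed.

End StandardSimplex.
Arguments stdsimplex : clear implicits.

Section FreeExtension.
Context {K : fieldType} {S : choiceType} {M : lmodType K}.

Definition fgext_fun (f : S -> M) : {freeg S / K} -> M := fglift f.

Lemma fgext_linear f : linear (fgext_fun f).
Proof.
have fB : {morph fgext_fun f : D E / D - E} := lift_is_additive f.
have f0 : fgext_fun f 0 = 0 by rewrite -(subrr 0) fB subrr.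
have fN : {morph fgext_fun f : D / - D} by move=> D; rewrite -sub0r fB f0 sub0r.
have fD : {morph fgext_fun f : D E / D + E}.
  by move=> D E; rewrite -{1}[E]opprK fB fN opprK.
have fs (I : Type) (r : seq I) F :
    fgext_fun f (\sum_(i <- r) F i) = \sum_(i <- r) fgext_fun f (F i).
  by elim: r => [|i r IH]; rewrite ?big_nil// !big_cons fD IH.
move=> a D E; rewrite fD; congr (_ + _).
rewrite -[D]freeg_sumE scaler_sumr !fs scaler_sumr.
apply: eq_bigr => x _.
have -> (k : K) : a *: << k *g x >> = << (a * k) *g x >> :> {freeg S / K}.
  by apply/eqP/freeg_eqP => y; rewrite coeffZ !coeffU mulrA.
by rewrite /fgext_fun !liftU scalerA.
Qed.

HB.instance Definition _ f :=
  GRing.isLinear.Build K {freeg S / K} M *:%R (fgext_fun f) (fgext_linear f).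

Definition fgext (f : S -> M) : {linear {freeg S / K} -> M} := fgext_fun f.

Lemma fgextU f k x : fgext f << k *g x >> = k *: f x.
Proof. exact: liftU. Qed.

Lemma freeg_eq_linear (f g : {linear {freeg S / K} -> M}) :
  (forall x, f << x >> = g << x >>) -> f =1 g.
Proof.
move=> fg D; rewrite -[D]freeg_sumE !linear_sum; apply: eq_bigr => x _.
have -> (k : K) : << k *g x >> = k *: << x >> :> {freeg S / K}.
  by apply/eqP/freeg_eqP => y; rewrite coeffZ !coeffU mul1r.
by rewrite !linearZZ fg.
Qed.

End FreeExtension.

Section SingularChains.
Context (R : realType) (K : fieldType).
Implicit Types X Y Z : topologicalType.

Definition singular n X : choiceType := continuousType (stdsimplex R n) X.

Definition chain n X : lmodType K := {freeg (singular n X) / K}.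

Definition push n X Y (f : continuousType X Y) :
    {linear chain n X -> chain n Y} :=
  fgext (fun s : singular n X => << (ccomp f s : singular n Y) >>).

(* The boundary operator is indexed by its source; in degree 0 the target
   chain 0.-1 is a dummy and the operator is zero, so that all 0-chains are
   cycles. *)
Definition bdry n X : {linear chain n X -> chain n.-1 X} :=
  match n with
  | 0 => \0
  | m.+1 => fgext (fun s : singular m.+1 X => \sum_(i < m.+2)
      << (-1) ^+ i *g (ccomp s (face R i) : singular m X) >>)
  end.

Lemma push_id n X : push n (@idfun X) =1 id.
Proof.
apply: (@freeg_eq_linear _ _ _ (push n (@idfun X)) idfun) => s /=.
rewrite fgextU scale1r; congr << _ >>.
exact/continuousEP.
Qed.

Lemma push_comp n X Y Z (f : continuousType X Y) (g : continuousType Y Z) c :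
  push n (ccomp g f) c = push n g (push n f c).
Proof.
apply: (@freeg_eq_linear _ _ _ (push n (ccomp g f)) (push n g \o push n f)).
move=> s /=; rewrite !fgextU !scale1r !fgextU scale1r; congr << _ >>.
exact/continuousEP.
Qed.

Lemma bdry_push n X Y (f : continuousType X Y) c :
  bdry n Y (push n f c) = push n.-1 f (bdry n X c).
Proof.
case: n => [|n] in c *; first by rewrite /= linear0.
apply: (@freeg_eq_linear _ _ _ (bdry n.+1 Y \o push n.+1 f)
  (push n f \o bdry n.+1 X)) => s /=.
rewrite !fgextU !scale1r !fgextU scale1r linear_sum; apply: eq_bigr => i _.
rewrite fgextU; apply/eqP/freeg_eqP => t; rewrite coeffZ !coeffU mul1r.
by congr (_ * (_ == _)%:R); exact/continuousEP.
Qed.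

Lemma bdry_bdry n X c : bdry n.-1 X (bdry n X c) = 0.
Proof.
case: n => [|[|n]] in c *; [by []|by []|].
apply: (@freeg_eq_linear _ _ _ (bdry n.+1 X \o bdry n.+2 X) \0) => s /=.
rewrite fgextU scale1r linear_sum.
pose F (p : 'I_n.+3 * 'I_n.+2) : chain n X :=
  << (-1) ^+ (p.1 + p.2) *g
     (ccomp s (ccomp (face R p.1) (face R p.2)) : singular n X) >>.
pose phi (p : 'I_n.+3 * 'I_n.+2) : 'I_n.+3 * 'I_n.+2 :=
  (lift p.1 p.2, inord (unbump p.2 p.1)).
have phiE p : (phi p).2 = unbump p.2 p.1 :> nat.
  by rewrite inordK//; exact: unbump_ltn.
have phi_lt p : ((phi p).2 < (phi p).1)%N = ~~ (p.2 < p.1)%N.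
  by rewrite phiE /= /bump /unbump; lia.
have phiK : involutive phi.
  move=> [j i]; rewrite /phi/= lift_swap; congr pair.
  apply: val_inj; rewrite /= !inordK /bump /unbump; have := ltn_ord j;
    have := ltn_ord i; lia.
have Fphi p : F (phi p) = - F p.
  rewrite /F freegUN [in RHS]face_face.
  suff -> : (-1) ^+ ((phi p).1 + (phi p).2) = - (-1) ^+ (p.1 + p.2) :> K by [].
  rewrite -signr_odd -[in RHS]signr_odd phiE /=.
  have -> : odd (bump p.1 p.2 + unbump p.2 p.1) = ~~ odd (p.1 + p.2).
    by rewrite /bump /unbump; case: (ltnP p.2 p.1) => ?; lia.
  by rewrite signrN.
transitivity (\sum_p F p).
  rewrite -(pair_bigA _ (fun j i => F (j, i))); apply: eq_bigr => j _.
  rewrite fgextU scaler_sumr; apply: eq_bigr => i _.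
  apply/eqP/freeg_eqP => t; rewrite coeffZ !coeffU mulrA -exprD.
  by congr (_ * (_ == _)%:R); exact/continuousEP.
rewrite (bigID (fun p : 'I_n.+3 * 'I_n.+2 => (p.2 < p.1)%N))/=.
rewrite [X in _ + X](reindex_inj (inv_inj phiK)).
under [X in _ + X]eq_bigl do rewrite phi_lt negbK.
by rewrite (eq_bigr _ (fun p _ => Fphi p)) sumrN subrr.
Qed.

End SingularChains.

Record top_pair := TopPair {
  tspace :> topologicalType;
  tsub : set tspace }.
Arguments tsub : clear implicits.

Record pair_map (P Q : top_pair) := PairMap {
  pair_fun :> continuousType P Q;
  pair_fun_sub : forall x, tsub P x -> tsub Q (pair_fun x) }.

Section RelativeHomology.
Context (R : realType) (K : fieldType).
Implicit Types P Q S : top_pair.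

Notation push := (push R K).
Notation bdry := (bdry R K).

Definition sub_chains n P : {linear chain R K n (tsub P) -> chain R K n P} :=
  push n (subincl (tsub P)).

(* C_n(X, A) = C_n(X) / C_n(A), where C_n(A) is embedded along A -> X. *)
Definition rchain n P : lmodType K := coker (sub_chains n P).

Lemma rbdry_subproof n P c :
  exists c', sub_chains n.-1 P c' = bdry n P (sub_chains n P c).
Proof. by exists (bdry n (tsub P) c); rewrite [RHS]bdry_push. Qed.

Definition rbdry n P : {linear rchain n P -> rchain n.-1 P} :=
  coker_map (@rbdry_subproof n P).

Lemma rbdry_rbdry n P c : rbdry n.-1 P (rbdry n P c) = 0.
Proof.
have [c' <-] := coker_surj c; rewrite [X in rbdry _ _ X]coker_map_funE.
by rewrite [LHS]coker_map_funE bdry_bdry linear0.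
Qed.

(* ker d_k / im d_k+1 for the complex of relative chains. *)
Definition homology k P : lmodType K :=
  coker (ker_lift (@rbdry_rbdry k.+1 P)).

Section InducedMap.
Context (P Q : top_pair) (f : pair_map P Q).

Definition sub_map : continuousType (tsub P) (tsub Q) :=
  corestr (f := ccomp f (subincl (tsub P)))
    (fun x => pair_fun_sub f (subincl_in x)).

Lemma rpush_subproof n c :
  exists c', sub_chains n Q c' = push n f (sub_chains n P c).
Proof.
exists (push n sub_map c); rewrite -!push_comp.
by congr (push n _ c); exact/continuousEP.
Qed.

Definition rpush n : {linear rchain n P -> rchain n Q} :=
  coker_map (rpush_subproof (n := n)).

Lemma rbdry_rpush n c : rbdry n Q (rpush n c) = rpush n.-1 (rbdry n P c).
Proof.
have [c' <-] := coker_surj c; rewrite [X in rbdry _ _ X]coker_map_funE.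
rewrite [X in rpush _ X]coker_map_funE [LHS]coker_map_funE [RHS]coker_map_funE.
by rewrite bdry_push.
Qed.

Lemma cycle_map_subproof n (z : ker (rbdry n P)) :
  rbdry n Q ((rpush n \o \val) z) = 0.
Proof. by rewrite /= rbdry_rpush (eqP (valP z)) linear0. Qed.

Definition cycle_map n : {linear ker (rbdry n P) -> ker (rbdry n Q)} :=
  ker_lift (@cycle_map_subproof n).

Lemma homology_map_subproof k (c : rchain k.+1 P) :
  exists c', ker_lift (@rbdry_rbdry k.+1 Q) c' =
    cycle_map k (ker_lift (@rbdry_rbdry k.+1 P) c).
Proof.
by exists (rpush k.+1 c); apply: val_inj; rewrite /= [LHS]rbdry_rpush.
Qed.

Definition homology_map k : {linear homology k P -> homology k Q} :=
  coker_map (@homology_map_subproof k).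

End InducedMap.

Lemma homology_map_id k P (f : pair_map P P) :
  f =1 id -> homology_map f k =1 id.
Proof.
move=> fid q; have [z <-] := coker_surj q.
rewrite [LHS]coker_map_funE; congr coker_pi; apply: val_inj => /=.
have [c <-] := coker_surj (\val z); rewrite [LHS]coker_map_funE; congr coker_pi.
rewrite -[RHS]push_id; congr (push k _ _).
exact/continuousEP.
Qed.

Lemma homology_map_comp k P Q S
    (f : pair_map P Q) (g : pair_map Q S) (h : pair_map P S) :
  h =1 g \o f -> forall q,
  homology_map h k q = homology_map g k (homology_map f k q).
Proof.
move=> hgf q; have [z <-] := coker_surj q.
rewrite [X in homology_map g k X]coker_map_funE.
rewrite [RHS]coker_map_funE [LHS]coker_map_funE.
congr coker_pi; apply: val_inj => /=.
have [c <-] := coker_surj (\val z); rewrite [X in rpush g k X]coker_map_funE.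
rewrite [RHS]coker_map_funE [LHS]coker_map_funE; congr coker_pi.
rewrite -push_comp; congr (push k _ _).
exact/continuousEP.
Qed.

End RelativeHomology.

Section Subpairs.
Context {T : topologicalType}.

(* (Y, C) for subspaces C, Y of T: Y is the subtype of T with the subspace
   topology. For C not contained in Y this is (Y, Y `&` C). *)
Definition subpair (Y C : set T) : top_pair :=
  @TopPair Y (set_val @^-1` C).

Definition subpair_incl (Y C Y' C' : set T)
    (YY' : Y `<=` Y') (CC' : C `<=` C') :
    pair_map (subpair Y C) (subpair Y' C') :=
  @PairMap (subpair Y C) (subpair Y' C') (incl YY')
    (fun x => CC' (set_val x)).

End Subpairs.

Record pers_module (K : fieldType) := PersModule {
  pers_obj :> nat -> lmodType K;
  pers_map : forall i j, (i <= j)%N -> {linear pers_obj i -> pers_obj j};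
  pers_map_id : forall i (ii : (i <= i)%N) x, pers_map ii x = x;
  pers_map_comp : forall i j k (ij : (i <= j)%N) (jk : (j <= k)%N)
    (ik : (i <= k)%N) x, pers_map ik x = pers_map jk (pers_map ij x) }.

Definition pers_iso (K : fieldType) (M N : pers_module K) : Prop :=
  exists f : forall i, {linear M i -> N i},
    (forall i, bijective (f i)) /\
    (forall i j (ij : (i <= j)%N) x,
       pers_map N ij (f i x) = f j (pers_map M ij x)).

Definition pers_group (K : fieldType) (M : pers_module K) i j
  (ij : (i <= j)%N) : lmodType K := img (pers_map M ij).

Definition lmod_iso (K : fieldType) (U V : lmodType K) : Prop :=
  exists f : {linear U -> V}, bijective f.

Section Filtrations.
Context {T : topologicalType}.

(* The union of the F i is not required to be X. *)
Definition filtration (X : set T) (F : nat -> set T) : Prop :=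
  (forall i, F i `<=` X) /\ (forall i j, (i <= j)%N -> F i `<=` F j).

Record filtered_pair (X A : set T) := FilteredPair {
  fp_sub : A `<=` X;
  fp_space : nat -> set T;
  fp_subspace : nat -> set T;
  fp_space_filtration : filtration X fp_space;
  fp_subspace_filtration : filtration A fp_subspace;
  fp_subspace_sub : forall i, fp_subspace i `<=` fp_space i }.

Lemma filtration_setI (A B : set T) (F G : nat -> set T) :
  filtration A F -> filtration B G ->
  filtration (A `&` B) (fun i => F i `&` G i).
Proof.
by move=> [FA Fm] [GB Gm]; split=> [i|i j ij]; apply: setISS; auto.
Qed.

Context (R : realType) (K : fieldType) (k : nat).
Context (X A : set T) (F : filtered_pair X A).

Let HF i := homology R K k (subpair (fp_space F i) (fp_subspace F i)).

Definition pers_homology_map i j (ij : (i <= j)%N) : {linear HF i -> HF j} :=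
  homology_map R K
    (subpair_incl ((fp_space_filtration F).2 i j ij)
                  ((fp_subspace_filtration F).2 i j ij)) k.

Lemma pers_homology_map_id i (ii : (i <= i)%N) x :
  pers_homology_map ii x = x.
Proof. by apply: homology_map_id => y; apply: val_inj. Qed.

Lemma pers_homology_map_comp i j l (ij : (i <= j)%N) (jl : (j <= l)%N)
    (il : (i <= l)%N) x :
  pers_homology_map il x = pers_homology_map jl (pers_homology_map ij x).
Proof. by apply: homology_map_comp => y; apply: val_inj. Qed.

Definition pers_homology : pers_module K :=
  PersModule pers_homology_map_id pers_homology_map_comp.

End Filtrations.

(* Interior in the subspace Y of the trace of S on Y, as a subset of T. *)
Definition relative_interior (T : topologicalType) (Y S : set T) : set T :=
  set_val @` (set_val @^-1` S : set Y)°.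

(* Abstract simplicial complexes of arbitrary cardinality and dimension. *)
Record simplicial_complex := SimplicialComplex {
  vertex : choiceType;
  simplices : set {fset vertex};
  simplex_neq0 : forall s, simplices s -> s != fset0;
  simplex_sub : forall s t, simplices s -> (t `<=` s)%fset -> t != fset0 ->
    simplices t }.

Section Realization.
Context (R : realType) (C : simplicial_complex).

(* Since its points vanish outside the finite set s, the topology of pointwise
   convergence induces on a closed simplex its Euclidean topology. *)
Definition closed_simplex (s : {fset vertex C}) : set {ptws vertex C -> R} :=
  [set x | [/\ forall v, 0 <= x v, forall v, v \notin s -> x v = 0
             & \sum_(v <- s) x v = 1]].

Record realization := Realization {
  bary :> {ptws vertex C -> R};
  bary_in : exists2 s, simplices s & closed_simplex s bary }.

HB.instance Definition _ := gen_eqMixin realization.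
HB.instance Definition _ := gen_choiceMixin realization.

(* Topology coherent with the closed simplices (not the metric topology). *)
Definition weak_open (U : set realization) : Prop :=
  forall s, simplices s ->
    open [set x : closed_simplex s | exists2 y, U y & bary y = set_val x].

Lemma realization_inj (x y : realization) : bary x = bary y -> x = y.
Proof.
case: x y => [x hx] [y hy] /= xy; rewrite xy in hx *.
by congr Realization; exact: Prop_irrelevance.
Qed.

Lemma weak_openT : weak_open setT.
Proof.
move=> s Cs; have -> : [set x : closed_simplex s | exists2 y : realization,
  setT y & bary y = set_val x] = setT; last exact: openT.
apply/seteqP; split=> // x _.
by exists (Realization (ex_intro2 _ _ s Cs (set_valP x))).
Qed.

Lemma weak_openI : setI_closed weak_open.
Proof.
move=> U V oU oV s Cs; have := openI (oU s Cs) (oV s Cs); congr open.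
apply/seteqP; split=> x [].
  by move=> [y Uy yx] [z Vz zx]; exists y => //; split=> //;
    rewrite (@realization_inj y z)// yx zx.
by move=> y [Uy Vy] yx; split; exists y.
Qed.

Lemma weak_open_bigcup (I : Type) (f : I -> set realization) :
  (forall i, weak_open (f i)) -> weak_open (\bigcup_i f i).
Proof.
move=> of_ s Cs.
have := @bigcup_open _ _ setT _ (fun i _ => of_ i s Cs); congr open.
apply/seteqP; split=> x.
  by move=> [i _ [y fy yx]]; exists y => //; exists i.
by move=> [y [i _ fy] yx]; exists i => //; exists y.
Qed.

HB.instance Definition _ := isOpenTopological.Build realization
  weak_openT weak_openI weak_open_bigcup.

End Realization.

Definition homeomorphic (X Y : topologicalType) : Prop :=
  exists (f : X -> Y) (g : Y -> X),
    [/\ continuous f, continuous g, cancel f g & cancel g f].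

Definition triangulable (R : realType) (X : topologicalType) : Prop :=
  exists C : simplicial_complex, homeomorphic (realization R C) X.

(* Main.v *)
From HB Require Import structures.
Require Import Defs.
From mathcomp Require Import freeg.
From mathcomp Require Import all_boot all_order all_algebra.
From mathcomp Require Import zify.
From mathcomp Require Import all_classical all_reals topology normedtype.
From mathcomp Require Import sequences.

(** For each index i the statement is excision for singular homology: if X_i
    is covered by the interiors of A_i and B_i, the inclusion of
    (B_i, A_i `&` B_i) into (X_i, A_i) induces an isomorphism in homology
    (subspace_excision). The inclusions commute with the structure maps of the
    two persistence modules, so these isomorphisms form an isomorphism of
    persistence modules, and it restricts to the images of the structure maps
    (pers_iso_group).

    Excision rests on barycentric subdivision sd. Both sd and a chain homotopy
    sd_htpy from sd to the identity are defined on the identity simplex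
    of Delta^n by coning from the barycenter and transported to any space by
    naturality; naturality makes them preserve the chains carried by a given
    subspace. The cone of an arbitrary continuous simplex is used, not only of
    an affine one, so that no separate complex of affine chains is needed: sd
    is a chain map and sd_htpy a homotopy by the formula for the boundary of a
    cone (bdry_cone, bdry_cone_bdry) and induction on the degree.

    Affinity matters only for the size of the pieces. The simplices in the
    subdivision of Delta^n are affine, and all their vertices are barycenters
    of faces containing one common vertex e_j of Delta^n, so that their j-th
    coordinates are at least 1 / (n + 1). A stochastic matrix with a column
    bounded below by e contracts the l1 distance of probability vectors by
    1 - e (spread_l1_lipschitz), so iterated subdivision of a simplex s gives
    simplices s \o t with t as contracting as desired; by Lebesgue's number
    lemma on the compact Delta^n, each of them ends up in A or in B
    (small_iter_sd). Hence a relative cycle is homologous modulo A to its small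
    iterated subdivision, whose part in A can be dropped: this gives
    surjectivity (excision_surj), and the same argument applied to a bounding
    chain gives injectivity (excision_inj). Chains of a subspace are recognized
    throughout by the simplices on which they are supported. *)

Set Implicit Arguments.
Unset Strict Implicit.
Unset Printing Implicit Defensive.

Import Order.TTheory GRing.Theory Num.Theory numFieldNormedType.Exports.

Local Open Scope classical_set_scope.
Local Open Scope ring_scope.

(** * Free modules: chains supported on a set of simplices *)

Section Supports.
Context {K : fieldType}.

Definition supported {S : choiceType} (P : set S) (c : {freeg S / K}) : Prop :=
  forall s, coeff s c != 0 -> P s.

Section Closure.
Context {S : choiceType}.
Implicit Types (P Q : set S) (c d : {freeg S / K}).

Lemma freegZ a b (s : S) :
  a *: << b *g s >> = << (a * b) *g s >> :> {freeg S / K}.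
Proof. by apply/eqP/freeg_eqP => t; rewrite coeffZ !coeffU mulrA. Qed.

Lemma supported0 P : supported P 0.
Proof. by move=> s; rewrite coeff0 eqxx. Qed.

Lemma supportedD P c d : supported P c -> supported P d -> supported P (c + d).
Proof.
move=> Pc Pd s; rewrite coeffD.
have [cs0|/Pc//] := eqVneq (coeff s c) 0.
by rewrite cs0 add0r => /Pd.
Qed.

Lemma supportedZ P a c : supported P c -> supported P (a *: c).
Proof. by move=> Pc s; rewrite coeffZ mulf_eq0 negb_or => /andP[_ /Pc]. Qed.

Lemma supportedB P c d : supported P c -> supported P d -> supported P (c - d).
Proof.
by move=> Pc Pd; rewrite -scaleN1r; apply: supportedD => //; exact: supportedZ.
Qed.

Lemma supportedU P a s : P s -> supported P << a *g s >>.
Proof.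
move=> Ps t; rewrite coeffU mulf_eq0 negb_or => /andP[_].
by have [<-//|] := eqVneq s t; rewrite eqxx.
Qed.

Lemma supported_sum P (I : Type) (r : seq I) (F : I -> {freeg S / K}) :
  (forall i, supported P (F i)) -> supported P (\sum_(i <- r) F i).
Proof.
by move=> PF; elim/big_rec: _ => [|i c _ Pc];
  [exact: supported0|exact: supportedD].
Qed.

Lemma supported_sub P Q c : P `<=` Q -> supported P c -> supported Q c.
Proof. by move=> PQ Pc s /Pc /PQ. Qed.

(** Since the support is finite, a property of all chains supported on P can be
    proved one simplex at a time. *)
Lemma supported_ind P c : supported P c -> forall G : {freeg S / K} -> Prop,
  G 0 -> (forall a s d, P s -> G d -> G (a *: << s >> + d)) -> G c.
Proof.
move=> Pc G G0 GD; rewrite -[c]freeg_sumE big_seq.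
elim/big_rec: _ => // s d; rewrite mem_dom => /Pc Ps Gd.
by rewrite -[coeff s c]mulr1 -freegZ; exact: GD.
Qed.

Lemma supported_split P Q c : supported (P `|` Q) c ->
  exists d e, [/\ supported P d, supported Q e & c = d + e].
Proof.
move=> PQc; pattern c.
apply: (supported_ind PQc) => [|a s f [Ps|Qs] [d [e [Pd Qe ->]]]].
- by exists 0, 0; rewrite addr0; split=> //; exact: supported0.
- exists (a *: << s >> + d), e; rewrite addrA; split=> //.
  by apply: supportedD => //; apply: supportedZ; exact: supportedU.
- exists d, (a *: << s >> + e); rewrite addrCA; split=> //.
  by apply: supportedD => //; apply: supportedZ; exact: supportedU.
Qed.

End Closure.

Lemma supported_linear {S S' : choiceType} (P : set S) (P' : set S')
    (f : {linear {freeg S / K} -> {freeg S' / K}}) c :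
  (forall s, P s -> supported P' (f << s >>)) ->
  supported P c -> supported P' (f c).
Proof.
move=> fP Pc; pattern c; apply: (supported_ind Pc) => [|a s d Ps Pd].
  by rewrite linear0; exact: supported0.
by rewrite linearP; apply: supportedD => //; apply: supportedZ; exact: fP.
Qed.

End Supports.

(** * Cones in a standard simplex *)

Section Cones.
Context {R : realType}.

Lemma stdsimplex_ge0 n (x : stdsimplex R n) i : 0 <= set_val x 0 i.
Proof. by have [] := set_valP x. Qed.

Lemma stdsimplex_sum n (x : stdsimplex R n) : \sum_i set_val x 0 i = 1.
Proof. by have [] := set_valP x. Qed.

Lemma stdsimplex_le1 n (x : stdsimplex R n) i : set_val x 0 i <= 1.
Proof.
rewrite -(stdsimplex_sum x) (bigD1 i)//= lerDl.
by apply: sumr_ge0 => j _; exact: stdsimplex_ge0.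
Qed.

Lemma stdsimplex_head n (x : stdsimplex R n.+1) :
  1 - set_val x 0 0 = \sum_k set_val x 0 (lift ord0 k).
Proof. by rewrite -(stdsimplex_sum x) big_ord_recl addrAC subrr add0r. Qed.

Lemma barycenter_subproof n : stdsimplex R n (const_mx n.+1%:R^-1).
Proof.
split=> [i|]; first by rewrite mxE invr_ge0 ler0n.
under eq_bigr do rewrite mxE.
by rewrite sumr_const card_ord -[_ *+ _]mulr_natr mulVf// pnatr_eq0.
Qed.

Definition barycenter n : stdsimplex R n :=
  exist _ (const_mx n.+1%:R^-1) (mem_set (barycenter_subproof n)).

(** The pointwise form of mx_continuous: tail is discontinuous at one point, so
    its continuity can only be treated point by point. *)
Lemma mx_continuous_at (X Y : topologicalType) m n (f : X -> 'M[Y]_(m, n)) x :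
  (forall i j, {for x, continuous (fun y => f y i j)}) -> {for x, continuous f}.
Proof.
move=> fc A [P Px PA].
have : \forall y \near x, forall ij : 'I_m * 'I_n, P ij.1 ij.2 (f y ij.1 ij.2).
  by apply: filter_forall => -[i j]; exact: (fc i j _ (Px i j)).
by apply: filterS => y Py; apply: PA => i j; exact: (Py (i, j)).
Qed.

(** The topology of a subspace is initial for its inclusion; this is
    continuous_comp_initial at a single point. *)
Lemma continuous_at_set_val (X Y : topologicalType) (S : set Y) (f : X -> S) x :
  {for x, continuous (set_val \o f)} -> {for x, continuous f}.
Proof.
move=> cf U [?/= [[W oW <-]]] /= Wfx /filterS; apply; apply: cf.
exact: open_nbhs_nbhs.
Qed.

Lemma coord_set_val_continuous n (S : set 'rV[R]_n) j :
  continuous (fun x : S => set_val x 0 j).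
Proof.
move=> x; apply: (@continuous_comp _ _ _ set_val (fun y : 'rV[R]_n => y 0 j)).
  exact: set_val_continuous.
exact: coord_continuous.
Qed.

Section Tail.
Context {n : nat}.

Definition tail_pt (t : 'rV[R]_n.+2) : 'rV[R]_n.+1 :=
  \row_k (t 0 (lift ord0 k) / (1 - t 0 0)).

Lemma tail_subproof (t : stdsimplex R n.+1) :
  set_val t 0 0 != 1 -> stdsimplex R n (tail_pt (set_val t)).
Proof.
move=> t1; split=> [i|].
  by rewrite mxE divr_ge0 ?stdsimplex_ge0// subr_ge0 stdsimplex_le1.
under eq_bigr do rewrite mxE.
by rewrite -mulr_suml -stdsimplex_head divff// subr_eq0 eq_sym.
Qed.

(** The projection of Delta^(n+1) from its vertex e_0 onto the opposite face,
    which is undefined at e_0; the barycenter is a default value there. *)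
Definition tail (t : stdsimplex R n.+1) : stdsimplex R n :=
  if pselect (stdsimplex R n (tail_pt (set_val t))) is left h
  then exist _ (tail_pt (set_val t)) (mem_set h) else barycenter n.

Lemma tailE (t : stdsimplex R n.+1) :
  set_val t 0 0 != 1 -> set_val (tail t) = tail_pt (set_val t).
Proof. by rewrite /tail => /tail_subproof h; case: pselect. Qed.

Lemma tail_continuous (t : stdsimplex R n.+1) :
  set_val t 0 0 != 1 -> {for t, continuous tail}.
Proof.
move=> t1; apply: continuous_at_set_val.
have near_t : nbhs t [set x : stdsimplex R n.+1 |
    set_val (tail x) = tail_pt (set_val x)].
  have near1 : nbhs (set_val t 0 0) [set a : R | a != 1].
    by apply: open_nbhs_nbhs; split; [exact: open_neq|].
  apply: (@filterS _ (nbhs t) _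
    [set x : stdsimplex R n.+1 | set_val x 0 0 != 1]) => [x|].
    exact: tailE.
  exact: coord_set_val_continuous near1.
have tail_pt_t : {for t, continuous (tail_pt \o set_val)}.
  apply: mx_continuous_at => i k; rewrite ord1.
  have -> : (fun x : stdsimplex R n.+1 => (tail_pt \o set_val) x 0 k) =
      (fun x => set_val x 0 (lift ord0 k) / (1 - set_val x 0 0)).
    by apply/funext => x; rewrite /= mxE.
  have cvg_coord j :
      (fun x : stdsimplex R n.+1 => set_val x 0 j) @ t --> set_val t 0 j.
    exact: coord_set_val_continuous.
  have t1' : 1 - set_val t 0 0 != 0 by rewrite subr_eq0 eq_sym.
  have cvg_cohead :
      (fun x : stdsimplex R n.+1 => 1 - set_val x 0 0) @ t -->
        1 - set_val t 0 0.
    exact: cvgB (cvg_cst (1 : R)) (cvg_coord 0).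
  exact: cvgM (cvg_coord (lift ord0 k)) (cvgV t1' cvg_cohead).
have tail_t : (set_val \o tail) t = (tail_pt \o set_val) t by exact: tailE.
move=> U; rewrite /prop_for /continuous_at tail_t => /tail_pt_t tU.
change (nbhs t ((set_val \o tail) @^-1` U)).
apply: (@filterS _ (nbhs t) _ ([set x : stdsimplex R n.+1 |
  set_val (tail x) = tail_pt (set_val x)] `&` (tail_pt \o set_val) @^-1` U)).
  by move=> x [/= ->].
exact: filterI.
Qed.

End Tail.

Section ConeSimplex.
Context {N n : nat} (b : stdsimplex R N).
Context (s : continuousType (stdsimplex R n) (stdsimplex R N)).

(** The join of the apex b with s. At the vertex e_0 the arbitrary value of tail
    is multiplied by 0. *)
Definition cone_pt (t : stdsimplex R n.+1) : 'rV[R]_N.+1 :=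
  set_val t 0 0 *: set_val b + (1 - set_val t 0 0) *: set_val (s (tail t)).

(** Away from e_0 this is a composition of continuous maps; at e_0 the second
    term is squeezed between 0 and 1 - t_0, because the coordinates of s lie
    in [0, 1]. *)
Lemma cone_pt_continuous : continuous cone_pt.
Proof.
apply: mx_continuous => i j t; rewrite ord1.
have -> : (fun x => cone_pt x 0 j) = (fun x => set_val x 0 0 * set_val b 0 j +
    (1 - set_val x 0 0) * set_val (s (tail x)) 0 j).
  by apply/funext => x; rewrite !mxE.
have cvg_head :
    (fun x : stdsimplex R n.+1 => set_val x 0 0) @ t --> set_val t 0 0.
  exact: coord_set_val_continuous.
have cvg_cohead :
    (fun x : stdsimplex R n.+1 => 1 - set_val x 0 0) @ t -->
        1 - set_val t 0 0.
  exact: cvgB (cvg_cst (1 : R)) cvg_head.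
apply: (cvgD (cvgM cvg_head (cvg_cst (set_val b 0 j)))).
have [t1|t1] := eqVneq (set_val t 0 0) 1.
  rewrite t1 subrr mul0r; rewrite t1 subrr in cvg_cohead.
  apply: (@squeeze_cvgr _ _ _ _ (cst 0)); last 2 first.
  - exact: cvg_cst.
  - exact: cvg_cohead.
  apply: nearW => x.
  rewrite mulr_ge0 ?stdsimplex_ge0 ?subr_ge0 ?stdsimplex_le1//=.
  by rewrite ler_piMr ?stdsimplex_le1// subr_ge0 stdsimplex_le1.
apply: cvgM => //.
apply: (@continuous_comp _ _ _ tail (fun y => set_val (s y) 0 j)).
  exact: tail_continuous.
apply: (@continuous_comp _ _ _ s (fun y => set_val y 0 j)).
  exact: cts_fun.
exact: coord_set_val_continuous.
Qed.

Lemma cone_pt_in t : stdsimplex R N (cone_pt t).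
Proof.
split=> [i|].
  by rewrite !mxE addr_ge0// mulr_ge0 ?stdsimplex_ge0 ?subr_ge0 ?stdsimplex_le1.
under eq_bigr do rewrite !mxE.
by rewrite big_split/= -!mulr_sumr !stdsimplex_sum !mulr1 addrC subrK.
Qed.

Definition cone_simplex :
    continuousType (stdsimplex R n.+1) (stdsimplex R N) :=
  corestr (f := mkcts cone_pt_continuous) cone_pt_in.

Lemma cone_simplexE t : set_val (cone_simplex t) = cone_pt t.
Proof. by []. Qed.

End ConeSimplex.

Lemma cone_simplex_face0 N n (b : stdsimplex R N)
    (s : continuousType (stdsimplex R n) (stdsimplex R N)) :
  ccomp (cone_simplex b s) (face R 0) = s.
Proof.
apply/continuousEP => x; apply: val_inj.
rewrite [LHS]/(cone_pt b s (face R 0 x)) /cone_pt.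
have x0 : set_val (face R 0 x) 0 0 = 0 :> R by exact: face_pt_i.
rewrite x0 scale0r add0r subr0 scale1r; congr (set_val (s _)).
apply: val_inj; rewrite [LHS]tailE; last by rewrite x0 eq_sym oner_eq0.
apply/rowP => k; rewrite mxE x0 subr0 divr1.
exact: face_pt_lift.
Qed.

(** The faces of a cone other than its base are the cones of the faces of the
    base. *)
Lemma cone_simplex_face_lift N n (b : stdsimplex R N) (i : 'I_n.+2)
    (s : continuousType (stdsimplex R n.+1) (stdsimplex R N)) :
  ccomp (cone_simplex b s) (face R (lift ord0 i)) =
  cone_simplex b (ccomp s (face R i)).
Proof.
apply/continuousEP => x; apply: val_inj.
rewrite [LHS]/(cone_pt b s (face R (lift ord0 i) x))
  [RHS]/(cone_pt b _ x) /cone_pt.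
have lift0 : 0 = lift (lift ord0 i) 0 :> 'I_n.+3 by apply: val_inj.
have x0 : set_val (face R (lift ord0 i) x) 0 0 = set_val x 0 0.
  by rewrite [X in _ 0 X]lift0; exact: face_pt_lift.
rewrite x0; have [->|x1] := eqVneq (set_val x 0 0) 1.
  by rewrite subrr !scale0r.
congr (_ + _ *: set_val (s _)); apply: val_inj.
rewrite [LHS]tailE ?x0//; rewrite [RHS]/(face_pt i (set_val (tail x))) tailE//.
apply/rowP => k; rewrite [LHS]mxE x0 [RHS]mxE; case: (unliftP i k) => [l ->|->].
  have -> : lift ord0 (lift i l) = lift (lift ord0 i) (lift ord0 l).
    by apply: val_inj; rewrite /= /bump/=; lia.
  by rewrite [X in X / _]face_pt_lift [RHS]mxE.
by rewrite [X in X / _]face_pt_i mul0r.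
Qed.

End Cones.

(** * Barycentric subdivision *)

Section Subdivision.
Context {R : realType} {K : fieldType}.
Implicit Types (X Y : topologicalType).

Local Notation Delta n := (stdsimplex R n).
Local Notation chain := (chain R K).
Local Notation bdry := (bdry R K).
Local Notation push := (push R K).

Lemma pushU n X Y (f : continuousType X Y) (s : singular R n X) :
  push n f << s >> = << (ccomp f s : singular R n Y) >>.
Proof. by rewrite fgextU scale1r. Qed.

Lemma bdryU n X (s : singular R n.+1 X) :
  bdry n.+1 X << s >> = \sum_(i < n.+2)
    << (-1) ^+ i *g (ccomp s (face R i) : singular R n X) >>.
Proof. by rewrite fgextU scale1r. Qed.

Section Cone.
Context {N : nat} (b : Delta N).

Definition cone n : {linear chain n (Delta N) -> chain n.+1 (Delta N)} :=
  fgext (fun s : singular R n (Delta N) =>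
    << (cone_simplex b s : singular R n.+1 (Delta N)) >>).

Lemma coneU n (s : singular R n (Delta N)) :
  cone n << s >> = << (cone_simplex b s : singular R n.+1 (Delta N)) >>.
Proof. by rewrite fgextU scale1r. Qed.

(** Coning is a contracting homotopy of the positive degree part of the chain
    complex of Delta^N. *)
Lemma bdry_cone n c :
  bdry n.+2 _ (cone n.+1 c) = c - cone n (bdry n.+1 _ c).
Proof.
apply: (@freeg_eq_linear _ _ _ (bdry n.+2 _ \o cone n.+1)
  (idfun \- (cone n \o bdry n.+1 _))) => s /=.
rewrite coneU !bdryU big_ord_recl expr0 cone_simplex_face0; congr (_ + _).
rewrite linear_sum -sumrN; apply: eq_bigr => i _.
rewrite [X in _ = - X]fgextU cone_simplex_face_lift freegZ mulr1 freegUN.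
by rewrite exprS mulN1r.
Qed.

(** The cone of a point is a segment, whose second end is the apex whatever the
    point. *)
Lemma cone_simplex_face1 (s s' : singular R 0 (Delta N)) :
  ccomp (cone_simplex b s) (face R (lift ord0 ord0)) =
  ccomp (cone_simplex b s') (face R (lift ord0 ord0)).
Proof.
apply/continuousEP => x; apply: val_inj.
rewrite [LHS]/(cone_pt b s (face R (lift ord0 ord0) x)).
rewrite [RHS]/(cone_pt b s' (face R (lift ord0 ord0) x)) /cone_pt.
have -> : set_val (face R (lift ord0 ord0) x) 0 0 = 1.
  rewrite -(stdsimplex_sum x) big_ord1.
  have {1}-> : 0 = lift (lift ord0 ord0) 0 :> 'I_2 by apply: val_inj.
  exact: face_pt_lift.
by rewrite subrr !scale0r.
Qed.

(** In degree 0 the boundary of a cone is c minus a multiple of the apex. The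
    multiple is the augmentation of c, which vanishes on boundaries. *)
Lemma bdry_cone_bdry c : bdry 1 _ (cone 0 (bdry 1 _ c)) = bdry 1 _ c.
Proof.
apply: (@freeg_eq_linear _ _ _ (bdry 1 _ \o cone 0 \o bdry 1 _) (bdry 1 _)).
move=> s /=.
have bdry_coneU t : bdry 1 _ (cone 0 << t >>) = << t >> -
    << (ccomp (cone_simplex b t) (face R (lift ord0 ord0)) : singular R 0 _) >>.
  by rewrite coneU bdryU big_ord_recl big_ord1 cone_simplex_face0 freegUN.
have -> : bdry 1 (Delta N) << s >> =
    << (ccomp s (face R 0) : singular R 0 _) >> -
    << (ccomp s (face R (lift ord0 ord0)) : singular R 0 _) >>.
  by rewrite bdryU big_ord_recl big_ord1 freegUN.
rewrite !linearB /= !bdry_coneU (cone_simplex_face1 _ (ccomp s (face R 0))).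
by rewrite opprB addrA subrK.
Qed.

End Cone.

Definition id_chain n : chain n (Delta n) :=
  << (@idfun (Delta n) : singular R n (Delta n)) >>.

Lemma push_id_chain n Y (s : singular R n Y) : push n s (id_chain n) = << s >>.
Proof. by rewrite pushU; congr << _ >>; exact/continuousEP. Qed.

(** The subdivision of the identity simplex of Delta^n is the cone of the
    subdivided boundary from the barycenter; that of s is its image under s. *)
Fixpoint sd n : forall Y, {linear chain n Y -> chain n Y} :=
  match n with
  | 0 => fun=> idfun
  | m.+1 => fun Y => fgext (fun s : singular R m.+1 Y =>
      push m.+1 s (cone (barycenter m.+1) m
        (sd m _ (bdry m.+1 _ (id_chain m.+1)))))
  end.

(** The operator D with bdry D + D bdry = id - sd, built like sd by coning the
    chain that has to be bounded. *)
Fixpoint sd_htpy n : forall Y, {linear chain n Y -> chain n.+1 Y} :=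
  match n with
  | 0 => fun=> \0
  | m.+1 => fun Y => fgext (fun s : singular R m.+1 Y =>
      push m.+2 s (cone (barycenter m.+1) m.+1
        (id_chain m.+1 - sd_htpy m _ (bdry m.+1 _ (id_chain m.+1)))))
  end.

(** By naturality sd is determined by its values on identity simplices, in all
    degrees alike. *)
Lemma sdU n Y (s : singular R n Y) :
  sd n Y << s >> = push n s (sd n _ (id_chain n)).
Proof.
case: n s => [|n] s; first by rewrite /= push_id_chain.
by rewrite /= !fgextU !scale1r; congr (push _ _ _); rewrite push_id.
Qed.

Lemma sd_push n X Y (f : continuousType X Y) c :
  sd n Y (push n f c) = push n f (sd n X c).
Proof.
apply: (@freeg_eq_linear _ _ _ (sd n Y \o push n f) (push n f \o sd n X)).
by move=> s /=; rewrite pushU sdU [in RHS]sdU push_comp.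
Qed.

Lemma sd_htpyU n Y (s : singular R n Y) :
  sd_htpy n Y << s >> = push n.+1 s (sd_htpy n _ (id_chain n)).
Proof.
case: n s => [|n] s; first by rewrite /= linear0.
by rewrite /= !fgextU !scale1r; congr (push _ _ _); rewrite push_id.
Qed.

Lemma sd_htpy_push n X Y (f : continuousType X Y) c :
  sd_htpy n Y (push n f c) = push n.+1 f (sd_htpy n X c).
Proof.
apply: (@freeg_eq_linear _ _ _ (sd_htpy n Y \o push n f)
  (push n.+1 f \o sd_htpy n X)).
by move=> s /=; rewrite pushU sd_htpyU [in RHS]sd_htpyU push_comp.
Qed.

Lemma sdS n Y (s : singular R n.+1 Y) : sd n.+1 Y << s >> =
  push n.+1 s (cone (barycenter n.+1) n (sd n _ (bdry n.+1 _ (id_chain n.+1)))).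
Proof. by rewrite [LHS]fgextU scale1r. Qed.

Lemma sd_htpyS n Y (s : singular R n.+1 Y) : sd_htpy n.+1 Y << s >> =
  push n.+2 s (cone (barycenter n.+1) n.+1
    (id_chain n.+1 - sd_htpy n _ (bdry n.+1 _ (id_chain n.+1)))).
Proof. by rewrite [LHS]fgextU scale1r. Qed.

Lemma bdry_sd n Y c : bdry n Y (sd n Y c) = sd n.-1 Y (bdry n Y c).
Proof.
elim: n Y c => [|n IH] Y c; first by [].
apply: (@freeg_eq_linear _ _ _ (bdry n.+1 Y \o sd n.+1 Y)
  (sd n Y \o bdry n.+1 Y)) => {c} s.
rewrite -[LHS]/(bdry n.+1 Y (sd n.+1 Y << s >>)).
rewrite -[RHS]/(sd n Y (bdry n.+1 Y << s >>)).
rewrite sdS bdry_push -[X in sd n Y (_ X)]push_id_chain bdry_push sd_push.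
congr (push _ _ _); case: n IH s => [|n] IH s; first exact: bdry_cone_bdry.
by rewrite bdry_cone IH (@bdry_bdry R K n.+2) linear0 [X in _ - X]linear0 subr0.
Qed.

Lemma bdry_sd_htpy n Y c : bdry n.+2 Y (sd_htpy n.+1 Y c) =
  c - sd n.+1 Y c - sd_htpy n Y (bdry n.+1 Y c).
Proof.
elim: n Y c => [|n IH] Y c.
  apply: (@freeg_eq_linear _ _ _ (bdry 2 Y \o sd_htpy 1 Y)
    (idfun \- sd 1 Y \- (sd_htpy 0 Y \o bdry 1 Y))) => {c} s.
  rewrite -[LHS]/(bdry 2 Y (sd_htpy 1 Y << s >>)).
  rewrite -[RHS]/(<< s >> - sd 1 Y << s >> - 0) subr0 sdS sd_htpyS.
  by rewrite bdry_push subr0 bdry_cone linearB push_id_chain.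
apply: (@freeg_eq_linear _ _ _ (bdry n.+3 Y \o sd_htpy n.+2 Y)
  (idfun \- sd n.+2 Y \- (sd_htpy n.+1 Y \o bdry n.+2 Y))) => {c} s.
rewrite -[LHS]/(bdry n.+3 Y (sd_htpy n.+2 Y << s >>)).
rewrite -[RHS]/(<< s >> - sd n.+2 Y << s >> -
  sd_htpy n.+1 Y (bdry n.+2 Y << s >>)).
rewrite sd_htpyS bdry_push bdry_cone [X in cone _ _ X]linearB.
rewrite [X in cone _ _ (_ - X)]IH (@bdry_bdry R K n.+2) linear0.
rewrite [X in _ - X]subr0 opprB addrCA subrr addr0 !linearB push_id_chain sdS.
rewrite -[in X in _ = _ - X](push_id_chain s).
rewrite (@bdry_push R K n.+2) sd_htpy_push.
by rewrite addrAC.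
Qed.

End Subdivision.

(** * Contraction of the l1 distance and Lebesgue numbers *)

Section Contraction.
Context {R : realType}.
Local Notation Delta n := (stdsimplex R n).

Definition l1dist n (x y : 'rV[R]_n) : R := \sum_i `|x 0 i - y 0 i|.

Lemma l1dist_coord n (x y : 'rV[R]_n) i : `|x 0 i - y 0 i| <= l1dist x y.
Proof.
by rewrite /l1dist (bigD1 i)//= lerDl; apply: sumr_ge0.
Qed.

Lemma l1dist_simplex_le2 n (x y : Delta n) :
  l1dist (set_val x) (set_val y) <= 2.
Proof.
have -> : 2 = \sum_i (set_val x 0 i + set_val y 0 i) :> R.
  by rewrite big_split/= !stdsimplex_sum.
apply: ler_sum => i _; apply: le_trans (ler_normB _ _) _.
by rewrite !ger0_norm ?stdsimplex_ge0.
Qed.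

Definition l1_lipschitz n N (s : Delta n -> Delta N) (a : R) : Prop :=
  forall x y, l1dist (set_val (s x)) (set_val (s y)) <=
    a * l1dist (set_val x) (set_val y).

(** Affine maps all of whose vertices have a common coordinate at least e; such
    maps bring points closer. *)
Definition spread n N (s : Delta n -> Delta N) (e : R) : Prop :=
  exists (M : 'M[R]_(n.+1, N.+1)) (j : 'I_N.+1),
    (forall x, set_val (s x) = set_val x *m M) /\ (forall i, e <= M i j).

Lemma spread_le n N (s : Delta n -> Delta N) e e' :
  e <= e' -> spread s e' -> spread s e.
Proof.
move=> ee' [M [j [sM Mj]]]; exists M, j; split=> // i; exact: le_trans (Mj i).
Qed.

Lemma vertex_subproof n i : Delta n (delta_mx 0 i).
Proof.
split=> [j|]; first by rewrite mxE eqxx ler0n.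
rewrite (bigD1 i)//= mxE !eqxx big1 ?addr0// => j /negPf ji.
by rewrite mxE ji andbF.
Qed.

(** The contraction coefficient of Dobrushin for stochastic matrices. *)
Lemma spread_l1_lipschitz n N (s : Delta n -> Delta N) e :
  spread s e -> l1_lipschitz s (1 - e).
Proof.
move=> [M [j [sM Mj]]] x y.
have rowM i : Delta N (row i M).
  rewrite rowE.
  pose v : Delta n := exist _ (delta_mx 0 i) (mem_set (vertex_subproof i)).
  by rewrite -[delta_mx 0 i]/(set_val v) -sM; exact: set_valP.
have M_ge0 i k : 0 <= M i k by have [/(_ k)] := rowM i; rewrite mxE.
have M_sum i : \sum_k M i k = 1.
  by have [_ <-] := rowM i; apply: eq_bigr => k _; rewrite mxE.
pose M' i k := M i k - e * (k == j)%:R.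
have M'_ge0 i k : 0 <= M' i k.
  by rewrite /M'; case: eqP => [->|_]; rewrite ?mulr1 ?mulr0 ?subr0 ?subr_ge0.
have M'_sum i : \sum_k M' i k = 1 - e.
  rewrite sumrB M_sum -mulr_sumr (bigD1 j)//= eqxx big1 ?addr0 ?mulr1//.
  by move=> k /negPf ->.
(* As the coordinates of x - y add up to 0, a constant can be subtracted from
   a column of M without changing (x - y) *m M. *)
have sM' k : set_val (s x) 0 k - set_val (s y) 0 k =
    \sum_i (set_val x 0 i - set_val y 0 i) * M' i k.
  rewrite !sM !mxE -sumrB /M'; under [RHS]eq_bigr do rewrite mulrBr.
  rewrite [RHS]sumrB -mulr_suml [X in _ - X * _]sumrB !stdsimplex_sum.
  rewrite subrr mul0r subr0.
  by apply: eq_bigr => i _; rewrite mulrBl.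
apply: (@le_trans _ _
    (\sum_k \sum_i `|set_val x 0 i - set_val y 0 i| * M' i k)).
  apply: ler_sum => k _; rewrite sM'; apply: le_trans (ler_norm_sum _ _ _) _.
  by apply: ler_sum => i _; rewrite normrM (ger0_norm (M'_ge0 i k)).
rewrite exchange_big/= mulr_sumr; apply: ler_sum => i _.
by rewrite -mulr_sumr M'_sum mulrC.
Qed.

Lemma spread_face n N (s : continuousType (Delta n) (Delta N)) i e :
  spread s e -> spread (ccomp (face R i) s) e.
Proof.
move=> [M [j [sM Mj]]].
exists (\matrix_(k, l) (if unlift i l is Some m then M k m else 0)), (lift i j).
split=> [x|k]; last by rewrite mxE liftK.
rewrite -[LHS]/(face_pt i (set_val (s x))) sM; apply/rowP => l; rewrite !mxE.
case: (unliftP i l) => [m ->|->].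
  by rewrite mxE; apply: eq_bigr => k _; rewrite mxE liftK.
by apply/esym/big1 => k _; rewrite mxE unlift_none mulr0.
Qed.

(** The barycenter has all its coordinates equal to 1 / (N + 1), so that taking
    it as an additional vertex keeps the bound on the common coordinate. *)
Lemma spread_cone n N (s : continuousType (Delta n) (Delta N)) :
  spread s N.+1%:R^-1 -> spread (cone_simplex (barycenter N) s) N.+1%:R^-1.
Proof.
move=> [M [j [sM Mj]]]; pose b := set_val (barycenter N : Delta N).
exists (\matrix_(k, l) (if unlift 0 k is Some m then M m l else b 0 l)), j.
split=> [x|k]; last first.
  by rewrite mxE; case: unlift => [m|]; [exact: Mj|rewrite /b /= mxE].
rewrite cone_simplexE /cone_pt sM; apply/rowP => l; rewrite !mxE.
rewrite [RHS]big_ord_recl mxE unlift_none; congr (_ + _).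
  by rewrite /b mxE.
under [RHS]eq_bigr do rewrite mxE liftK.
have [x1|x1] := eqVneq (set_val x 0 0) 1.
  rewrite x1 subrr mul0r; apply/esym/big1 => k _.
  have : \sum_k set_val x 0 (lift ord0 k) = 0.
    by rewrite -stdsimplex_head x1 subrr.
  move/eqP; rewrite psumr_eq0 => [/allP /(_ k)|i _]; last exact: stdsimplex_ge0.
  by rewrite mem_index_enum => /(_ isT) /eqP ->; rewrite mul0r.
rewrite mulr_sumr; apply: eq_bigr => k _; rewrite tailE// mxE.
by rewrite mulrA mulrCA divff ?mulr1// subr_eq0 eq_sym.
Qed.

End Contraction.

Section Lebesgue.
Context {R : realType}.
Local Notation Delta n := (stdsimplex R n).

Lemma stdsimplex_compact n : compact (Delta n).
Proof.
apply: (@subclosed_compact _ _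
  [set v : 'rV[R]_n.+1 | forall i, `[0, 1]%classic (v 0 i)]).
- have -> : Delta n = (\bigcap_i [set x : 'rV[R]_n.+1 | 0 <= x 0 i]) `&`
      [set x | \sum_i x 0 i = 1].
    by apply/seteqP; split=> x [x0 x1]; split=> // i *; exact: x0.
  apply: closedI.
    apply: closed_bigI => i _.
    apply: (@preimage_closed _ _ (fun x : 'rV[R]_n.+1 => x 0 i)
      [set a | 0 <= a]) => [x _|].
      exact: coord_continuous.
    exact: closed_ge.
  apply: (@preimage_closed _ _ (fun x : 'rV[R]_n.+1 => \sum_i x 0 i)
    [set 1]) => [x _|].
    apply: (@continuous_big R _ +%R 0) => [|i _]; first exact: add_continuous.
    exact: coord_continuous.
  exact: closed_eq.
- apply: (@rV_compact R n.+1 (fun=> `[0, 1]%classic)) => i.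
  exact: segment_compact.
- move=> x Dx i; rewrite /= in_itv/=.
  pose v : Delta n := exist _ x (mem_set Dx).
  by rewrite (stdsimplex_ge0 v) (stdsimplex_le1 v).
Qed.

(** The compactness of Delta^n is used for a subset of the ambient space, in its
    near-covering form: an admissible e at each point, uniform nearby, gives
    one for all points. Therefore the property P of the proof is extended to
    all points of that space. *)
Lemma lebesgue_number n (U V : set (Delta n)) : (forall x, U° x \/ V° x) ->
  exists2 e : R, 0 < e & forall x : Delta n,
    (forall y, l1dist (set_val x) (set_val y) < e -> U y) \/
    (forall y, l1dist (set_val x) (set_val y) < e -> V y).
Proof.
move=> UV.
pose P (e : R) (v : 'rV[R]_n.+1) :=
  (forall y : Delta n, l1dist v (set_val y) < e -> U y) \/
  (forall y : Delta n, l1dist v (set_val y) < e -> V y).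
have ball_sub (x : Delta n) (W : set (Delta n)) : W° x ->
    exists2 r : R, 0 < r &
      forall y : Delta n, ball (set_val x) r (set_val y) -> W y.
  move=> [_ [[W' oW' <-] W'x W'W]].
  have /nbhs_ballP[r r0 rW'] : nbhs (set_val x) W' by exact: open_nbhs_nbhs.
  by exists r => // y /rW'; exact: W'W.
have near_P (x : 'rV[R]_n.+1) : Delta n x ->
    \forall x' \near x & e \near 0^'+, P e x'.
  move=> Dx; pose v : Delta n := exist _ x (mem_set Dx).
  have lift_ball (W : set (Delta n)) : W° v ->
      \forall x' \near x & e \near (0:R)^'+,
        forall y : Delta n, l1dist x' (set_val y) < e -> W y.
    move=> /ball_sub[r r0 rW]; exists (ball x (r / 2), [set e | e < r / 2]).
      by split; [apply: nbhsx_ballx|apply: nbhs_right_lt]; rewrite divr_gt0.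
    move=> [x' e] [/= xx' er] y ye; apply: rW.
    apply: (@ball_split _ _ x') => //.
    split=> [|i j]; first by rewrite divr_gt0.
    rewrite ord1 -ball_normE /=; apply: le_lt_trans (l1dist_coord _ _ j) _.
    exact: lt_trans er.
  by case: (UV v) => /lift_ball; apply: filterS => -[x' e] ?; [left|right].
have near_cover := iffLR (compact_near_coveringP _) (@stdsimplex_compact n).
have nP : \forall e \near (0 : R)^'+, Delta n `<=` P e.
  exact: (near_cover R 0^'+ P _ near_P).
have [e [e0 eP]] : exists e : R, 0 < e /\ Delta n `<=` P e.
  near (0:R)^'+ => e; exists e; split.
    by near: e; exact: nbhs_right_gt.
  by near: e.
by exists e => // x; apply: eP; exact: set_valP.
Unshelve. all: by end_near.
Qed.

End Lebesgue.

(** * Small chains *)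

Section SmallChains.
Context {R : realType} {K : fieldType}.
Implicit Types (X Y : topologicalType).
Local Notation Delta n := (stdsimplex R n).
Local Notation chain := (chain R K).
Local Notation bdry := (bdry R K).
Local Notation push := (push R K).

Lemma spread_sd_id_chain n : supported
  [set s : singular R n (Delta n) | spread s n.+1%:R^-1]
  (sd n _ (id_chain n) : chain n (Delta n)).
Proof.
elim: n => [|n IH].
  apply: supportedU; exists 1%:M, 0; split=> [x|i]; first by rewrite mulmx1.
  by rewrite ord1 mxE eqxx invr1.
rewrite sdS push_id; apply: (@supported_linear _ _ _
    [set s : singular R n (Delta n.+1) | spread s n.+2%:R^-1]) => [s sP|].
  by rewrite coneU; apply: supportedU; exact: spread_cone.
rewrite bdryU linear_sum; apply: supported_sum => i.
rewrite -[(-1) ^+ i]mulr1 -freegZ linearZ; apply: supportedZ.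
rewrite sdU; apply: supported_linear IH => s sP; rewrite pushU.
apply: supportedU; apply: (@spread_le _ _ _ _ _ n.+1%:R^-1).
  by rewrite lef_pV2 ?posrE ?ltr0n// ler_nat.
suff -> : ccomp (ccomp idfun (face R i)) s = ccomp (face R i) s.
  exact: spread_face.
exact/continuousEP.
Qed.

(** By naturality, iterated subdivision composes the simplices that occur in the
    subdivision of Delta^n, and their contraction factors multiply. *)
Lemma supported_iter_sd n Y (s : singular R n Y) m : supported
  [set u : singular R n Y | exists2 t : continuousType (Delta n) (Delta n),
    l1_lipschitz t ((1 - n.+1%:R^-1) ^+ m) & u = ccomp s t]
  (iter m (sd n Y) << s >> : chain n Y).
Proof.
elim: m => [|m IH].
  apply: supportedU; exists idfun => [x y|]; first by rewrite expr0 mul1r.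
  exact/continuousEP.
apply: supported_linear IH => _ [t t_lip ->].
rewrite sdU; apply: supported_linear (@spread_sd_id_chain n) => u u_spread.
rewrite pushU; apply: supportedU; exists (ccomp t u); last exact/continuousEP.
move=> x y; apply: le_trans (t_lip _ _) _.
rewrite exprSr -mulrA ler_wpM2l//; last exact: spread_l1_lipschitz.
by rewrite exprn_ge0// subr_ge0 invf_le1 ?ltr0n// ler1n.
Qed.

Definition inside {n Y} (S : set Y) : set (singular R n Y) :=
  [set s | forall x, S (s x)].

Lemma iter_sdP n Y m a c d : iter m (sd n Y) (a *: c + d : chain n Y) =
  a *: iter m (sd n Y) c + iter m (sd n Y) d.
Proof. by elim: m => //= m ->; rewrite linearP. Qed.

Lemma supported_push n X Y (S : set Y) (f : continuousType X Y)
    (c : chain n X) :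
  (forall x, S (f x)) -> supported (inside S) (push n f c).
Proof.
move=> fS; apply: (@supported_linear _ _ _ setT) => // s _.
by rewrite pushU; apply: supportedU => x; exact: fS.
Qed.

Lemma supported_bdry n Y (S : set Y) (c : chain n Y) :
  supported (inside S) c -> supported (inside S) (bdry n Y c).
Proof.
case: n c => [|n] c; first by move=> _; exact: supported0.
apply: supported_linear => s sS; rewrite bdryU; apply: supported_sum => i.
by apply: supportedU => x; exact: sS.
Qed.

Lemma supported_sd n Y (S : set Y) (c : chain n Y) :
  supported (inside S) c -> supported (inside S) (sd n Y c).
Proof.
by apply: supported_linear => s sS; rewrite sdU; exact: supported_push.
Qed.

Lemma supported_iter_sd_inside n Y (S : set Y) m (c : chain n Y) :
  supported (inside S) c -> supported (inside S) (iter m (sd n Y) c).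
Proof. by move=> Sc; elim: m => //= m; exact: supported_sd. Qed.

Lemma supported_sd_htpy n Y (S : set Y) (c : chain n Y) :
  supported (inside S) c -> supported (inside S) (sd_htpy n Y c).
Proof.
by apply: supported_linear => s sS; rewrite sd_htpyU; exact: supported_push.
Qed.

Lemma bdry_iter_sd n Y m (c : chain n Y) :
  bdry n Y (iter m (sd n Y) c) = iter m (sd n.-1 Y) (bdry n Y c).
Proof. by elim: m => //= m <-; exact: bdry_sd. Qed.

(** The homotopy sd_htpy preserves chains carried by S, so modulo such chains
    subdivision does not change the class of a relative cycle. In degree 0
    subdivision is the identity. *)
Lemma iter_sd_homologous n Y (S : set Y) m (c : chain n Y) :
  supported (inside S) (bdry n Y c) ->
  exists e : chain n.+1 Y,
    supported (inside S) (c - iter m (sd n Y) c - bdry n.+1 Y e).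
Proof.
move=> Sdc; elim: m => [|m [e Se]].
  by exists 0; rewrite linear0 !subrr; exact: supported0.
case: n c Sdc e Se => [|n] c Sdc e Se; first by exists e.
pose c' := iter m (sd n.+1 Y) c.
exists (e + sd_htpy n.+1 Y c').
have -> : c - iter m.+1 (sd n.+1 Y) c - bdry n.+2 Y (e + sd_htpy n.+1 Y c') =
    (c - c' - bdry n.+2 Y e) + sd_htpy n Y (bdry n.+1 Y c').
  rewrite linearD /= bdry_sd_htpy -/c'.
  rewrite [_ - _ - sd_htpy _ _ _]addrAC addrA opprB addrA subrK.
  by rewrite opprD opprB !addrA addrAC [in LHS](addrAC c).
apply: supportedD => //; apply: supported_sd_htpy.
by rewrite bdry_iter_sd; exact: supported_iter_sd_inside.
Qed.

Section Cover.
Context {Y : topologicalType} (A B : set Y).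
Context (AB : forall y, A° y \/ B° y).

(** The pieces of the m-th subdivision have l1 diameter at most 2 a^m for some
    a < 1, which falls below a Lebesgue number of the cover pulled back by s. *)
Lemma small_iter_sd_simplex n (s : singular R n Y) : exists m,
  supported (inside A `|` inside B) (iter m (sd n Y) << s >> : chain n Y).
Proof.
have s_int (S : set Y) x : S° (s x) -> (s @^-1` S)° x.
  by move=> Sx; exact: (@cts_fun _ _ s x _ Sx).
have cover x : (s @^-1` A)° x \/ (s @^-1` B)° x.
  by case: (AB (s x)) => /s_int; [left|right].
have [e e0 eAB] := lebesgue_number cover.
pose a : R := 1 - n.+1%:R^-1.
have a0 : 0 <= a by rewrite subr_ge0 invf_le1 ?ltr0n// ler1n.
have a1 : a < 1 by rewrite ltrBlDr ltrDl invr_gt0 ltr0n.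
have [m am] : exists m, a ^+ m * 2 < e.
  have : (fun m => a ^+ m) @ \oo --> (0 : R).
    by apply: cvg_expr; rewrite ger0_norm.
  move=> /cvgrPdist_lt /(_ (e / 2)); rewrite divr_gt0// => /(_ isT)
    [m _ /(_ m)].
  rewrite sub0r normrN /= leqnn ger0_norm ?exprn_ge0// => /(_ isT) am.
  by exists m; rewrite -ltr_pdivlMr.
exists m; have sm := @supported_iter_sd n Y s m.
apply: (supported_sub _ sm) => _ [t t_lip ->].
have near_t x : l1dist (set_val (t (barycenter n))) (set_val (t x)) < e.
  apply: le_lt_trans (t_lip _ _) (le_lt_trans _ am).
  by rewrite ler_wpM2l ?exprn_ge0//; exact: l1dist_simplex_le2.
by case: (eAB (t (barycenter n))) => tW; [left|right] => x; exact: tW.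
Qed.

(** The number of subdivisions depends on the simplex; the numbers for the
    finitely many simplices of c can be added because further subdivision
    keeps a chain small. *)
Lemma small_iter_sd n (c : chain n Y) : exists m,
  supported (inside A `|` inside B) (iter m (sd n Y) c).
Proof.
pose small (d : chain n Y) := supported (inside A `|` inside B) d.
have small_iter m d : small d -> small (iter m (sd n Y) d).
  move=> /supported_split[a [b [Aa Bb ->]]].
  rewrite -[a]scale1r iter_sdP scale1r; apply: supportedD.
    apply: (@supported_sub _ _ (inside A)) => [s sA|]; first by left.
    exact: supported_iter_sd_inside.
  apply: (@supported_sub _ _ (inside B)) => [s sB|]; first by right.
  exact: supported_iter_sd_inside.
have allT : supported setT c by [].
pattern c; apply: (supported_ind allT) => [|a s d _ [m md]].
  by exists 0%N; exact: supported0.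
have [k ks] := small_iter_sd_simplex s.
exists (m + k)%N; rewrite iter_sdP; apply: supportedD.
  by apply: supportedZ; rewrite iterD; exact: small_iter.
by rewrite addnC iterD; exact: small_iter.
Qed.

Lemma iter_sd_split n (c : chain n Y) : exists m a b,
  [/\ supported (inside A) a, supported (inside B) b &
      iter m (sd n Y) c = a + b].
Proof.
have [m /supported_split[a [b [Aa Bb cab]]]] := small_iter_sd c.
by exists m, a, b; split.
Qed.

End Cover.
End SmallChains.

(** * Excision *)

Section Excision.
Context {R : realType} {K : fieldType}.
Implicit Types (X Y : topologicalType) (P Q : top_pair).
Local Notation chain := (chain R K).
Local Notation bdry := (bdry R K).
Local Notation push := (push R K).
Local Notation sub_chains := (sub_chains R K).
Local Notation rbdry := (rbdry R K).
Local Notation homology := (homology R K).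

Lemma iter_sd_push n X Y (f : continuousType X Y) m (c : chain n X) :
  iter m (sd n Y) (push n f c) = push n f (iter m (sd n X) c).
Proof. by elim: m => //= m ->; rewrite sd_push. Qed.

Lemma iter_sdB n Y m (c d : chain n Y) :
  iter m (sd n Y) (c - d) = iter m (sd n Y) c - iter m (sd n Y) d.
Proof. by rewrite -scaleN1r addrC iter_sdP scaleN1r addrC. Qed.

Lemma push_lift n X Y (f : continuousType X Y) (S : set Y) (c : chain n Y) :
  (forall s : singular R n Y, inside S s ->
     exists t : singular R n X, ccomp f t = s) ->
  supported (inside S) c -> exists d, push n f d = c.
Proof.
move=> f_lift Sc; pattern c; apply: (supported_ind Sc) => [|a s _ Ss [d <-]].
  by exists 0; rewrite linear0.
have [t <-] := f_lift s Ss.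
by exists (a *: << t >> + d); rewrite linearP pushU.
Qed.

(** Composition with an injective map identifies no two simplices. *)
Lemma coeff_push n X Y (f : continuousType X Y) (s : singular R n X) c :
  injective f -> coeff (ccomp f s : singular R n Y) (push n f c) = coeff s c.
Proof.
move=> f_inj; have allT : supported setT c by [].
pattern c; apply: (supported_ind allT) => [|a t d _ IH].
  by rewrite linear0 !coeff0.
rewrite linearP !coeffD IH !coeffZ pushU !coeffU.
congr (_ * (_ * (nat_of_bool _)%:R) + _).
apply/eqP/eqP => [/continuousEP ft|->//].
by apply/continuousEP => x; apply: f_inj; exact: ft.
Qed.

(** This plays the part of the equality between the chains of an intersection of
    subspaces and the intersection of their groups of chains: a chain of X
    whose image is carried by S is itself carried by the preimage of S. *)
Lemma supported_push_inj n X Y (f : continuousType X Y) (S : set Y)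
    (c : chain n X) : injective f ->
  supported (inside S) (push n f c) -> supported (inside (f @^-1` S)) c.
Proof.
move=> f_inj Sc s; rewrite -(coeff_push _ _ f_inj) => /Sc fs x; exact: fs.
Qed.

(** The submodule divided out in relative chains is that of the chains carried
    by the subspace. *)
Lemma sub_chainsP n P (c : chain n P) :
  supported (inside (tsub P)) c <-> exists d, sub_chains n P d = c.
Proof.
split=> [|[d <-]]; last first.
  by apply: supported_push => x; exact: subincl_in.
apply: push_lift => s Ps; exists (corestr Ps : singular R n (tsub P)).
exact/continuousEP.
Qed.

Section Classes.
Context {k : nat} {P : top_pair}.
Implicit Types z w : chain k P.

(** Relative homology is handled on representatives in the absolute chain
    complex. *)
Definition rel_cycle z : Prop := supported (inside (tsub P)) (bdry k P z).

Lemma rel_cycleP z :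
  rel_cycle z <-> coker_pi (sub_chains k P) z \in ker_pred (rbdry k P).
Proof.
rewrite unfold_in [rbdry k P _]coker_map_funE.
split=> [/sub_chainsP[d dz]|/eqP].
  by apply/eqP; rewrite -(linear0 (coker_pi (sub_chains k.-1 P)));
    apply/coker_piP; exists d; rewrite subr0.
rewrite -(linear0 (coker_pi (sub_chains k.-1 P))) => /coker_piP[d dz].
by apply/sub_chainsP; exists d; rewrite dz subr0.
Qed.

Definition rel_class z (zP : rel_cycle z) : homology k P :=
  coker_pi (ker_lift (@rbdry_rbdry R K k.+1 P))
    (exist _ (coker_pi (sub_chains k P) z) (iffLR (rel_cycleP z) zP)
      : ker (rbdry k P)).

Lemma rel_class_surj (q : homology k P) : exists z zP, q = @rel_class z zP.
Proof.
have [[r rP] <-] := coker_surj q.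
have [z zr] := coker_surj r; case: _ / zr rP => zP.
exists z, (iffRL (rel_cycleP z) zP); congr coker_pi; exact: val_inj.
Qed.

Lemma rel_class_eq z w (zP : rel_cycle z) (wP : rel_cycle w) :
  rel_class zP = rel_class wP <->
  exists e, supported (inside (tsub P)) (z - w - bdry k.+1 P e).
Proof.
split=> [/coker_piP[r]|[e /sub_chainsP[d dE]]].
  have [e <-] := coker_surj r => /(congr1 val) /=.
  rewrite [rbdry _ _ _]coker_map_funE -linearB => /esym/coker_piP[d dE].
  by exists e; apply/sub_chainsP; exists d.
apply/coker_piP; exists (coker_pi _ e); apply: val_inj => /=.
rewrite [LHS]coker_map_funE -linearB; apply/esym/coker_piP.
by exists d.
Qed.

End Classes.

Lemma rel_cycle_push k P Q (f : pair_map P Q) (z : chain k P) :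
  rel_cycle z -> rel_cycle (push k f z).
Proof.
rewrite /rel_cycle bdry_push; apply: supported_linear => s sP.
by rewrite pushU; apply: supportedU => x; apply: pair_fun_sub; exact: sP.
Qed.

Lemma homology_map_rel_class k P Q (f : pair_map P Q) (z : chain k P)
    (zP : rel_cycle z) :
  homology_map R K f k (rel_class zP) = rel_class (rel_cycle_push (f := f) zP).
Proof.
rewrite [LHS]coker_map_funE; congr coker_pi; apply: val_inj => /=.
exact: coker_map_funE.
Qed.

Section ExcisivePair.
Context {P Q : top_pair} (f : pair_map P Q).
Context (f_inj : injective f).
Context (f_lift : forall n (s : singular R n Q), inside (range f) s ->
  exists t : singular R n P, ccomp f t = s).
Context (f_sub : forall x, tsub Q (f x) -> tsub P x).
Context (f_cover : forall y, (tsub Q)° y \/ (range f)° y).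

Lemma supported_sub_push n (c : chain n P) :
  supported (inside (tsub Q)) (push n f c) -> supported (inside (tsub P)) c.
Proof.
move=> /(supported_push_inj f_inj); apply: supported_sub => s Qs x.
exact/f_sub/Qs.
Qed.

(** Write a subdivision of z as a + b with a carried by tsub Q and b by the
    range of f. Then z is homologous to b modulo tsub Q, and b lifts to P. *)
Lemma excision_surj k (z : chain k Q) : rel_cycle z -> exists b : chain k P,
  rel_cycle b /\
  exists e, supported (inside (tsub Q)) (z - push k f b - bdry k.+1 Q e).
Proof.
move=> zQ; have [m [a [b' [Qa fb' sdz]]]] := iter_sd_split f_cover z.
have [b bE] := push_lift (@f_lift k) fb'; exists b; split.
  apply: supported_sub_push; rewrite -bdry_push bE.
  have -> : b' = iter m (sd k Q) z - a by rewrite sdz addrC addKr.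
  rewrite linearB /= bdry_iter_sd; apply: supportedB.
    exact: supported_iter_sd_inside.
  exact: supported_bdry.
have [e eQ] := iter_sd_homologous m zQ; exists e.
have -> : z - push k f b - bdry k.+1 Q e =
    z - iter m (sd k Q) z - bdry k.+1 Q e + a.
  by rewrite bE sdz opprD !addrA (addrAC _ _ a) (addrAC _ _ a) subrK.
exact: supportedD.
Qed.

(** If the image of b is the boundary of w modulo tsub Q, subdivide w until it
    splits as a + c with c lifting to P. Then the subdivision of b differs from
    the boundary of the lift of c by a chain whose image is carried by tsub Q,
    and which is therefore carried by tsub P. *)
Lemma excision_inj k (b : chain k P) (w : chain k.+1 Q) : rel_cycle b ->
  supported (inside (tsub Q)) (push k f b - bdry k.+1 Q w) ->
  exists e, supported (inside (tsub P)) (b - bdry k.+1 P e).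
Proof.
move=> bP bwQ; have [m [a [c' [Qa fc' sdw]]]] := iter_sd_split f_cover w.
have [c cE] := push_lift (@f_lift k.+1) fc'.
have [e eP] := iter_sd_homologous m bP; exists (c + e).
have -> : b - bdry k.+1 P (c + e) =
    b - iter m (sd k P) b - bdry k.+1 P e + (iter m (sd k P) b - bdry k.+1 P c).
  rewrite linearD /= opprD !addrA [LHS]addrAC; congr (_ - _).
  by rewrite [RHS]addrAC subrK.
apply: supportedD => //; apply: supported_sub_push.
rewrite linearB -iter_sd_push -[X in _ - X](@bdry_push R K k.+1) cE.
have -> : iter m (sd k Q) (push k f b) - bdry k.+1 Q c' =
    iter m (sd k Q) (push k f b - bdry k.+1 Q w) + bdry k.+1 Q a.
  rewrite iter_sdB -(@bdry_iter_sd _ _ k.+1) sdw linearD /=.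
  by rewrite opprD addrA [RHS]addrAC subrK.
apply: supportedD; first exact: supported_iter_sd_inside.
exact: (@supported_bdry _ _ k.+1).
Qed.

Lemma excision k : bijective (homology_map R K f k).
Proof.
rewrite -setTT_bijective; split=> // [q r _ _|q _].
  have [b [bP ->]] := rel_class_surj q; have [c [cP ->]] := rel_class_surj r.
  rewrite !homology_map_rel_class => /rel_class_eq[w].
  rewrite -linearB => bcw; apply/rel_class_eq; apply: excision_inj bcw.
  by rewrite /rel_cycle linearB; exact: supportedB.
have [z [zQ ->]] := rel_class_surj q.
have [b [bP zb]] := excision_surj zQ.
exists (rel_class bP) => //; rewrite homology_map_rel_class.
apply/esym/rel_class_eq; exact: zb.
Qed.

End ExcisivePair.
End Excision.

(** * Isomorphisms of persistence modules *)

Section Persistence.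
Context {K : fieldType}.

Lemma linear_bij_inv (U V : lmodType K) (f : {linear U -> V}) :
  bijective f -> exists g : {linear V -> U}, cancel f g /\ cancel g f.
Proof.
move=> [g fK gK].
have g_linear : linear g.
  by move=> a u v; apply: (can_inj fK); rewrite linearP !gK.
pose G : {linear V -> U} :=
  HB.pack g (GRing.isLinear.Build K V U *:%R g g_linear).
by exists G.
Qed.

Lemma pers_iso_sym (M N : pers_module K) : pers_iso M N -> pers_iso N M.
Proof.
move=> [f [f_bij f_nat]].
have g_ i := cid (linear_bij_inv (f_bij i)).
exists (fun i => projT1 (g_ i)); split=> [i|i j ij x].
  by have [fK gK] := projT2 (g_ i); exists (f i).
have [fK gK] := projT2 (g_ i); have [fK' _] := projT2 (g_ j).
by rewrite -{2}[x]gK f_nat fK'.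
Qed.

Lemma img_predP (U V : lmodType K) (f : {linear U -> V}) v :
  v \in img_pred f <-> exists u, f u = v.
Proof. by rewrite unfold_in; split=> /asboolP. Qed.

Lemma pers_iso_group (M N : pers_module K) i j (ij : (i <= j)%N) :
  pers_iso M N -> lmod_iso (pers_group M ij) (pers_group N ij).
Proof.
move=> [f [f_bij f_nat]].
have f_img (v : pers_group M ij) : f j (val v) \in img_pred (pers_map N ij).
  have /img_predP[u <-] := valP v.
  by apply/img_predP; exists (f i u); rewrite f_nat.
pose h (v : pers_group M ij) : pers_group N ij :=
  exist _ (f j (val v)) (f_img v).
have h_linear : linear h by move=> a u v; apply: val_inj; rewrite /= linearP.
pose H : {linear pers_group M ij -> pers_group N ij} :=
  HB.pack h (GRing.isLinear.Build K _ _ *:%R h h_linear).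
exists H; rewrite -setTT_bijective; split=> // [u v _ _|w _].
  by move=> /(congr1 val) /(bij_inj (f_bij j)) /val_inj.
have /img_predP[u uw] := valP w; have [g fK gK] := f_bij i.
have vP : pers_map M ij (g u) \in img_pred (pers_map M ij).
  by apply/img_predP; exists (g u).
exists (exist _ (pers_map M ij (g u)) vP : pers_group M ij) => //.
by apply: val_inj; rewrite /= -f_nat gK.
Qed.

End Persistence.

Section SubspaceExcision.
Context {R : realType} (K : fieldType) {T : topologicalType} {Y A B : set T}.
Context (BY : B `<=` Y)
  (YAB : Y = relative_interior Y A `|` relative_interior Y B).

Definition excision_incl :
    pair_map (subpair B (A `&` B)) (subpair Y A) :=
  subpair_incl BY (@subIsetl _ A B).

Lemma subspace_excision k : bijective (homology_map R K excision_incl k).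
Proof.
have inclE x : set_val (excision_incl x) = set_val x by [].
have rangeP y : range excision_incl y <-> B (set_val y).
  split=> [[x _ <-]|By]; first by rewrite inclE; exact: set_valP.
  by exists (exist _ (set_val y) (mem_set By)) => //; apply: val_inj.
apply: excision => [x x' /(congr1 val) xx'|n s s_range|x Ax|y].
- exact: val_inj.
- have sB x : B (set_val (s x)) by apply/rangeP.
  exists (corestr (f := ccomp (subincl Y) s) sB).
  by apply/continuousEP => x; apply: val_inj.
- by split=> //; exact: set_valP.
have interior_val (S : set T) : relative_interior Y S (set_val y) ->
    (set_val @^-1` S : set Y)° y.
  by move=> [y' Sy' /val_inj <-].
have : (relative_interior Y A `|` relative_interior Y B) (set_val y).
  by rewrite -YAB; exact: set_valP.
move=> [/interior_val yA|/interior_val yB]; first by left.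
right; apply: (@filterS _ (nbhs y) _ (set_val @^-1` B)) yB => x Bx.
exact/rangeP.
Qed.

End SubspaceExcision.

Theorem theorem2 (R : realType) (K : fieldType)
  (X : topologicalType) (X_triangulable : triangulable R X)
  (A B : set X) (A_neq0 : A !=set0) (B_neq0 : B !=set0)
  (X_cover : [set: X] = A° `|` B°)
  (X_ A_ B_ : nat -> set X)
  (X_filtration : filtration [set: X] X_)
  (A_filtration : filtration A A_)
  (B_filtration : filtration B B_)
  (A_sub_X : forall i, A_ i `<=` X_ i)
  (B_sub_X : forall i, B_ i `<=` X_ i)
  (X_i_cover : forall i, X_ i =
     relative_interior (X_ i) (A_ i) `|` relative_interior (X_ i) (B_ i)) :
  let XA := FilteredPair (@subsetT _ A) X_filtration A_filtration A_sub_X in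
  let BAB := FilteredPair (@subIsetr _ A B) B_filtration
    (filtration_setI A_filtration B_filtration)
    (fun i => @subIsetr _ (A_ i) (B_ i)) in
  (forall k : nat,
     pers_iso (pers_homology R K k XA) (pers_homology R K k BAB)) /\
  (forall (k i j : nat) (ij : (i < j)%N),
     lmod_iso (pers_group (pers_homology R K k XA) (ltnW ij))
              (pers_group (pers_homology R K k BAB) (ltnW ij))).
Proof.
move=> XA BAB.
have iso k : pers_iso (pers_homology R K k XA) (pers_homology R K k BAB).
  apply: pers_iso_sym.
  exists (fun i => homology_map R K (excision_incl (A := A_ i) (B_sub_X i)) k).
  split=> [i|i j ij x].
    exact: (subspace_excision K (B_sub_X i) (X_i_cover i)).
  have BX : B_ i `<=` X_ j.
    by apply: subset_trans (B_sub_X j); exact: B_filtration.2.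
  have AX : A_ i `&` B_ i `<=` A_ j.
    by apply: subset_trans (@subIsetl _ _ _) _; exact: A_filtration.2.
  transitivity (homology_map R K (subpair_incl BX AX) k x).
    by apply/esym; apply: homology_map_comp => y; exact: val_inj.
  by apply: homology_map_comp => y; exact: val_inj.
split=> [k|k i j ij]; first exact: iso.
exact/pers_iso_group/iso.
Qed.
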